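(* Let $X$ be a $d$-box and let $E$ be a set with exactly $2^d$ elements. A map $\lambda$ from the set of proper boxes of $X$ to $E$ is a dyadic labelling if and only if there exist a partition $\mathcal{F}$ of $P:=\mathrm{pud}(X_1)\times\cdots\times\mathrm{pud}(X_d)$ into pairwise dichotomous (in $P$) equicomplementary boxes and a bijection $g:\mathcal{F}\to E$ such that $\lambda=g\circ\lambda_{\mathcal{F}}$.
   Context: A $d$-box is $X=X_1\times\cdots\times X_d$ with finite nonempty sets $X_i$. A box is a nonempty $A_1\times\cdots\times A_d$ with $A_i\subseteq X_i$, proper if $A_i\neq X_i$ for all $i$. Two boxes $A,B$ form a twin pair if for some $i$, $A_j=B_j$ for $j\neq i$ and $A_i=X_i\setminus B_i$. A map $\lambda$ from proper boxes of $X$ to $E$ is a dyadic labelling if it is surjective and whenever $A,B$ and $C,D$ are twin pairs of proper boxes with $A\cup B=C\cup D$, then $\{\lambda(A),\lambda(B)\}=\{\lambda(C),\lambda(D)\}$. Let $\mathrm{pud}(X_i)$ denote the family of nonempty proper subsets of $X_i$; each proper box $A$ of $X$ is identified with $(A_1,\dots,A_d)\in P=\mathrm{pud}(X_1)\times\cdots\times\mathrm{pud}(X_d)$, and $P$ is regarded as a $d$-box, with boxes of $P$ and dichotomy in $P$ defined accordingly ($\mathcal{B},\mathcal{B}'$ dichotomous if $\mathcal{B}_i=\mathrm{pud}(X_i)\setminus\mathcal{B}'_i$ for some $i$). A box $\mathcal{B}=\mathcal{B}_1\times\cdots\times\mathcal{B}_d$ of $P$ is equicomplementary if for each $i$ and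 each $C\in\mathrm{pud}(X_i)$ exactly one of $C$, $X_i\setminus C$ belongs to $\mathcal{B}_i$. For a partition $\mathcal{F}$ of $P$ into boxes, $\lambda_{\mathcal{F}}(A)$ denotes the unique member of $\mathcal{F}$ containing $A$. *)

(* Defs.v *)
From mathcomp Require Import all_boot.

Set Implicit Arguments.
Unset Strict Implicit.
Unset Printing Implicit Defensive.

Section Boxes.
Variables (d : nat) (T : 'I_d -> finType).

Definition point : finType := {dffun forall i : 'I_d, T i}.

Definition is_box (A : {set point}) : bool :=
  (A != set0) && [exists S : {dffun forall i : 'I_d, {set T i}}, A == setXn S].

(* The i-th factor of a box, recovered as a projection; see [factorE]. *)
Definition factor (A : {set point}) (i : 'I_d) : {set T i} :=
  [set x i | x : point in A].

Lemma factorE (S : forall i : 'I_d, {set T i}) (i : 'I_d) :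
  setXn S != set0 -> factor (setXn S) i = S i.
Proof.
case/set0Pn=> y /setXnP Sy; apply/setP => a; apply/imsetP/idP => [|Sa].
  by case=> x /setXnP Sx ->.
have [z zE] : exists z : point, forall j,
    z j = if @eqP _ i j is ReflectT e then ecast k (T k) e a else y j.
  by exists (finfun (fun j =>
    if @eqP _ i j is ReflectT e then ecast k (T k) e a else y j))
    => j; rewrite ffunE.
exists z; last first.
  by rewrite zE; case: eqP => // e; rewrite (eq_axiomK e).
by apply/setXnP => j; rewrite zE; case: eqP => [e|_]; [case: j / e|].
Qed.

Definition is_proper_box (A : {set point}) : bool :=
  is_box A && [forall i, factor A i != [set: T i]].

Definition dichotomous (A B : {set point}) : Prop :=
  exists i : 'I_d, factor A i = ~: factor B i.

Definition twin_pair (A B : {set point}) : Prop :=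
  exists i : 'I_d,
    (forall j, j != i -> factor A j = factor B j) /\ factor A i = ~: factor B i.

Definition proper_box : Type := {A : {set point} | is_proper_box A}.

End Boxes.

Definition pud (T : finType) : finType :=
  {C : {set T} | (C != set0) && (C != [set: T])}.

Lemma pudC_subproof (T : finType) (C : pud T) :
  (~: val C != set0) && (~: val C != [set: T]).
Proof.
case: C => C /= /andP[C0 CT].
apply/andP; split; [move: CT | move: C0]; apply: contra => /eqP CE.
  by rewrite -[C]setCK CE setC0.
by rewrite -[C]setCK CE setCT.
Qed.

Definition pudC (T : finType) (C : pud T) : pud T :=
  exist _ (~: val C) (pudC_subproof C).

Section Labellings.
Variables (d : nat) (X : 'I_d -> finType).

Definition dyadic_labelling (E : finType) (lam : proper_box X -> E) : Prop :=
  (forall e : E, exists A, lam A = e) /\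
  (forall A B C D : proper_box X,
     twin_pair (val A) (val B) -> twin_pair (val C) (val D) ->
     val A :|: val B = val C :|: val D ->
     [set lam A; lam B] = [set lam C; lam D]).

Definition pudX (i : 'I_d) : finType := pud (X i).

Lemma proper_factor_subproof (A : proper_box X) (i : 'I_d) :
  (factor (val A) i != set0) && (factor (val A) i != [set: X i]).
Proof.
case: A => A /= /andP[/andP[/set0Pn[x Ax] _] /forallP ->]; rewrite andbT.
by apply/set0Pn; exists (x i); apply: imset_f.
Qed.

(* The identification of a proper box A with (A_1, ..., A_d) in P. *)
Definition to_P (A : proper_box X) : point pudX :=
  [ffun i => exist _ (factor (val A) i) (proper_factor_subproof A i) : pudX i].

Definition equicomplementary (B : {set point pudX}) : Prop :=
  is_box B /\
  forall (i : 'I_d) (C : pud (X i)),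
    (C \in factor B i) (+) (pudC C \in factor B i).

Lemma lambdaF_subproof (F : {set {set point pudX}}) :
  partition F [set: point pudX] -> forall A, pblock F (to_P A) \in F.
Proof. by move=> /and3P[/eqP cF _ _] A; apply: pblock_mem; rewrite cF inE. Qed.

Definition lambdaF (F : {set {set point pudX}})
    (partF : partition F [set: point pudX]) (A : proper_box X) :
    {B : {set point pudX} | B \in F} :=
  exist _ (pblock F (to_P A)) (lambdaF_subproof partF A).

End Labellings.

(* Main.v *)
(** Read on P, the twin-pair condition says that for each direction i the pair
    of labels of a point and of its i-th complement is constant along every
    line in direction i.  Hence the set of labels of the orbit of a point under
    all complementations is unchanged when one coordinate is modified, so it is
    the same for all points; by surjectivity it is E, and as #|E| = 2^d the
    labelling is injective on every orbit.  The same argument with coordinate i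
    frozen shows that two points with complementary i-th coordinates have
    different labels.  This forces every fibre to be an equicomplementary box,
    and disjoint equicomplementary boxes are dichotomous.  Conversely, an
    equicomplementary box that meets a line in direction i contains exactly one
    point of each twin pair on that line. *)

Require Import Defs.
From mathcomp Require Import all_boot.

Set Implicit Arguments.
Unset Strict Implicit.
Unset Printing Implicit Defensive.

(** * Points of a product and coordinatewise replacement *)

Section Points.
Variables (d : nat) (Y : 'I_d -> finType).
Implicit Types (x y z : point Y) (i : 'I_d) (B : {set point Y}).

Definition upd x i (a : Y i) : point Y := [ffun j => dfwith x a j].

Lemma upd_in x i (a : Y i) : upd x a i = a.
Proof. by rewrite ffunE dfwith_in. Qed.

Lemma upd_out x i (a : Y i) j : i != j -> upd x a j = x j.
Proof. by move=> ij; rewrite ffunE dfwith_out. Qed.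

(* One may pass from x to y by changing a single coordinate at a time. *)
Lemma point_path_ind (P : point Y -> Prop) x y :
  P x -> (forall z i, P z -> x i != y i -> P (upd z (y i))) -> P y.
Proof.
move=> Px Pupd; pose D z := [set i | z i != y i].
(* Induction on the number of coordinates still to be corrected; the inclusion in [D x] ensures that
   only coordinates where [x] and [y] differ are ever changed. *)
suff H n z : #|D z| <= n -> D z \subset D x -> P z -> P y.
  exact: (H _ x (leqnn _) (subxx _) Px).
elim: n z => [|n IH] z.
  rewrite leqn0 cards_eq0 => /eqP D0 _.
  suff -> : z = y by [].
  apply/ffunP => i; apply/eqP; move/setP/(_ i): D0.
  by rewrite !inE => /negbFE.
move=> Dn Dx Pz; have [D0|[i Di]] := set_0Vmem (D z).
  by apply: (IH z) => //; rewrite D0 cards0.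
have subD : D (upd z (y i)) \subset D z :\ i.
  apply/subsetP => j; rewrite !inE; have [->|ij] := eqVneq i j.
    by rewrite upd_in eqxx.
  by rewrite upd_out.
apply: (IH (upd z (y i))).
- rewrite -ltnS; apply: leq_trans Dn.
  by rewrite (cardsD1 i (D z)) Di ltnS; apply: subset_leq_card.
- by apply: subset_trans Dx; apply: subset_trans subD (subsetDl _ _).
by apply: Pupd => //; move/subsetP/(_ i Di): Dx; rewrite inE.
Qed.

Lemma factorP B i (a : Y i) :
  reflect (exists2 x, x \in B & x i = a) (a \in factor B i).
Proof. by apply: (iffP imsetP) => -[x Bx]; exists x. Qed.

Lemma mem_factor B x i : x \in B -> x i \in factor B i.
Proof. by move=> Bx; apply/factorP; exists x. Qed.

Lemma mem_box B x : is_box B -> (x \in B) = [forall i, x i \in factor B i].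
Proof.
case/andP=> B0 /existsP[S /eqP BE]; rewrite {1}BE.
apply/setXnP/forallP => H i; move: (H i); rewrite BE factorE -?BE //.
Qed.

(** Any point of the product of the factors of [B] is reached from a point of [B] by importing, one
    at a time, coordinates of members of [B]. *)
Lemma box_of_upd B : B != set0 ->
  (forall x y i, x \in B -> y \in B -> upd x (y i) \in B) -> is_box B.
Proof.
move=> B0 Bupd; rewrite /is_box B0; apply/existsP.
exists [ffun i => factor B i]; apply/eqP/setP => y; apply/idP/setXnP => [By i|yB].
  by rewrite ffunE mem_factor.
case/set0Pn: B0 => x Bx.
apply: (@point_path_ind (fun z => z \in B) x y) => // z i Bz _.
have := yB i; rewrite ffunE => /factorP[w Bw <-]; exact: Bupd.
Qed.

End Points.

(** * Labellings of a product with an involution on each factor *)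

Section Flips.
Variables (d : nat) (Y : 'I_d -> finType) (c : forall i, Y i -> Y i).
Hypothesis cK : forall i, involutive (@c i).
Implicit Types (x y z : point Y) (i : 'I_d) (S K : {set 'I_d}).

Definition flip S x : point Y := [ffun j => if j \in S then c (x j) else x j].

Lemma flipE S x j : flip S x j = if j \in S then c (x j) else x j.
Proof. by rewrite ffunE. Qed.

Lemma flip0 x : flip set0 x = x.
Proof. by apply/ffunP => j; rewrite flipE inE. Qed.

Definition toggle i S := if i \in S then S :\ i else i |: S.

Lemma in_toggle i S j : (j \in toggle i S) = (j == i) (+) (j \in S).
Proof.
by rewrite /toggle; case: ifPn => iS; rewrite !inE; case: eqVneq => // ->;
   rewrite ?iS ?(negPf iS).
Qed.

Lemma flip_toggle i S x : flip (toggle i S) x = flip [set i] (flip S x).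
Proof.
apply/ffunP => j; rewrite !flipE in_toggle inE.
by case: eqP => // _; case: (j \in S) => //=; rewrite cK.
Qed.

Definition agree_off i x y := forall j, j != i -> x j = y j.

Lemma agree_off_flip i S x y :
  agree_off i x y -> agree_off i (flip S x) (flip S y).
Proof. by move=> xy j ji; rewrite !flipE xy. Qed.

Lemma agree_off_upd x i (a : Y i) : agree_off i x (upd x a).
Proof. by move=> j ji; rewrite upd_out // eq_sym. Qed.

(** The twin-pair condition read on points: [agree_off i x y] will amount to equality of the unions
    of the two twin pairs in direction [i]. *)
Definition line_constant (E : finType) (mu : point Y -> E) :=
  forall i x y, agree_off i x y ->
    [set mu x; mu (flip [set i] x)] = [set mu y; mu (flip [set i] y)].

Section DyadicMap.
Variables (E : finType) (mu : point Y -> E).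
Hypotheses (mu_line : line_constant mu)
  (mu_surj : forall e, exists x, mu x = e) (cardE : #|E| = 2 ^ d).

(** [K] is the set of coordinates allowed to flip: [setT] gives the full orbit, [[set~ i]] freezes
    coordinate [i]. *)
Definition orbit_labels K x := [set mu (flip S x) | S in powerset K].

(** By line constancy, the label at [flip S x] recurs over the modified point at index [S] or
    [toggle i S], and both lie in [K] because [i] does. *)
Lemma orbit_labels_upd K x i (a : Y i) :
  i \in K -> orbit_labels K x \subset orbit_labels K (upd x a).
Proof.
move=> iK; apply/subsetP => _ /imsetP[S SK ->].
have := mu_line (agree_off_flip S (agree_off_upd x a)).
move/setP/(_ (mu (flip S x))); rewrite !inE eqxx /= => /esym.
rewrite -flip_toggle => /orP[] /eqP ->; apply: imset_f => //.
move: SK; rewrite !powersetE => /subsetP SK; apply/subsetP => j.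
by rewrite in_toggle; have [->|_ /SK] := eqVneq j i.
Qed.

Lemma orbit_labels_sub K x y : (forall j, j \notin K -> x j = y j) ->
  orbit_labels K x \subset orbit_labels K y.
Proof.
move=> xy; pose P z := orbit_labels K x \subset orbit_labels K z.
apply: (@point_path_ind _ _ P) => [|z i xz xyi]; first exact: subxx.
apply: subset_trans xz (orbit_labels_upd _ _ _).
by apply: contraNT xyi => /xy ->.
Qed.

(** Every label occurs on the orbit of [x], so the map from the 2^d sets [S] to the 2^d labels is
    onto, hence injective. *)
Lemma flip_label_inj x : injective (fun S => mu (flip S x)).
Proof.
have surj : orbit_labels setT x = setT.
  apply/setP => e; rewrite [RHS]inE; have [y <-] := mu_surj e.
  apply: (subsetP (@orbit_labels_sub setT y x _)) => [j|]; first by rewrite inE.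
  by apply/imsetP; exists set0; rewrite ?flip0 // powersetE sub0set.
have /imset_injP inj : #|orbit_labels setT x| == #|powerset [set: 'I_d]|.
  by rewrite surj cardsT cardE card_powerset cardsT card_ord.
by move=> S S'; apply: inj; rewrite powersetE subsetT.
Qed.

(* The labels of the points with a given i-th coordinate a are the 2^(d-1)
   labels of any half-orbit over a; the half-orbit over [c a] carries the
   remaining ones. *)
Lemma opposite_label_neq x y i : x i = c (y i) -> mu x != mu y.
Proof.
move=> xy; set y' := flip [set i] y.
have: mu x \in orbit_labels [set~ i] y'.
  apply: (subsetP (@orbit_labels_sub [set~ i] x y' _)) => [j|].
    by rewrite !inE negbK => /eqP ->; rewrite flipE inE eqxx xy.
  by apply/imsetP; exists set0; rewrite ?flip0 // powersetE sub0set.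
case/imsetP=> S; rewrite powersetE => /subsetP SK ->.
have iS : i \notin S by apply/negP => /SK; rewrite !inE eqxx.
(* Seen from [y], the index contains [i], so it differs from the index [set0] of [y] itself and
   injectivity on the orbit applies. *)
have -> : flip S y' = flip (toggle i S) y.
  apply/ffunP => j; rewrite !flipE in_toggle inE.
  by case: eqVneq => [->|//]; rewrite (negPf iS).
apply/eqP; rewrite -{2}[y]flip0 => /flip_label_inj/setP/(_ i).
by rewrite in_toggle inE eqxx (negPf iS).
Qed.

Definition fibre e := [set x | mu x == e].

(** For [x] and [y] labelled [e], line constancy puts [e] on [upd x (y i)] or on its [i]-th flip;
    the flip is excluded, since its [i]-th coordinate is opposite to that of [y]. *)
Lemma fibre_box e : is_box (fibre e).
Proof.
apply: box_of_upd => [|x y i]; rewrite ?inE.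
  by have [x xe] := mu_surj e; apply/set0Pn; exists x; rewrite inE xe.
move=> /eqP xe /eqP ye; have := mu_line (agree_off_upd x (y i)).
move/setP/(_ e); rewrite !inE xe eqxx /= => /esym/orP[/eqP <-//|/eqP H].
have /negP[] : mu (flip [set i] (upd x (y i))) != mu y.
  by apply: (@opposite_label_neq _ _ i); rewrite flipE inE eqxx upd_in.
by rewrite -H ye.
Qed.

(** Opposite coordinates carry different labels, so not both occur; one does, by line constancy on
    the line in direction [i] through a point labelled [e]. *)
Lemma fibre_equicomplementary e i (a : Y i) :
  (a \in factor (fibre e) i) (+) (c a \in factor (fibre e) i).
Proof.
have [Ha|Ha] /= := boolP (a \in factor (fibre e) i).
  apply/negP => /factorP[x]; rewrite inE => /eqP xe xi.
  case/factorP: Ha => y; rewrite inE -xe => /eqP ye yi.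
  have /eqP[] // : mu x != mu y.
  by apply: (@opposite_label_neq _ _ i); rewrite yi.
have [x xe] := mu_surj e; have := mu_line (agree_off_upd x a).
move/setP/(_ e); rewrite !inE xe eqxx /= => /esym/orP[] /eqP H.
  by case/factorP: Ha; exists (upd x a); rewrite ?upd_in // inE -H.
apply/factorP; exists (flip [set i] (upd x a)); rewrite ?inE -?H //.
by rewrite flipE inE eqxx upd_in.
Qed.

End DyadicMap.
End Flips.

(** * Proper boxes as points of P, and equicomplementary boxes of P *)

Section ProperBoxes.
Variables (d : nat) (X : 'I_d -> finType).
Implicit Types (A B C D : proper_box X) (p q : point (pudX X)) (i : 'I_d).

Lemma pudCK (T : finType) : involutive (@pudC T).
Proof. by move=> C; apply: val_inj; rewrite /= setCK. Qed.

Local Notation flip := (@flip d (pudX X) (fun i => @pudC (X i))).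
Local Notation line_constant :=
  (@line_constant d (pudX X) (fun i => @pudC (X i)) _).

Lemma val_to_P A i : val (to_P A i) = factor (val A) i.
Proof. by rewrite ffunE. Qed.

Lemma proper_box_is_box A : is_box (val A).
Proof. by case/andP: (valP A). Qed.

Lemma mem_proper_box A (x : point X) :
  (x \in val A) = [forall i, x i \in val (to_P A i)].
Proof.
rewrite (mem_box _ (proper_box_is_box A)).
by apply: eq_forallb => i; rewrite val_to_P.
Qed.

Lemma to_P_inj : injective (@to_P d X).
Proof.
by move=> A B AB; apply/val_inj/setP => x; rewrite !mem_proper_box AB.
Qed.

Definition pud_box p : {set point X} := setXn (fun i => val (p i)).

Lemma pud_box_neq0 p : pud_box p != set0.
Proof.
have ne i : exists a, a \in val (p i).
  by apply/set0Pn; case/andP: (valP (p i)).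
apply/set0Pn; exists [ffun i => xchoose (ne i)].
by apply/setXnP => i; rewrite ffunE; apply: xchooseP.
Qed.

Lemma pud_box_proper p : is_proper_box (pud_box p).
Proof.
apply/andP; split; last first.
  apply/forallP => i; rewrite factorE; last exact: pud_box_neq0.
  by case/andP: (valP (p i)).
rewrite /is_box pud_box_neq0; apply/existsP.
exists [ffun i => val (p i)]; apply/eqP/eq_setXn => i; by rewrite ffunE.
Qed.

Definition of_P p : proper_box X := exist _ (pud_box p) (pud_box_proper p).

Lemma of_PK : cancel of_P (@to_P d X).
Proof.
move=> p; apply/ffunP => i; apply: val_inj.
by rewrite val_to_P factorE // pud_box_neq0.
Qed.

Lemma to_PK : cancel (@to_P d X) of_P.
Proof. by move=> A; apply: to_P_inj; rewrite of_PK. Qed.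

Lemma twin_pairP A B :
  twin_pair (val A) (val B) <-> exists i, to_P B = flip [set i] (to_P A).
Proof.
split=> -[i].
  case=> ABj ABi; exists i; apply/ffunP => j; apply: val_inj.
  rewrite flipE inE; case: eqVneq => [->|ji] /=; rewrite !val_to_P.
    by rewrite ABi setCK.
  by rewrite ABj.
move=> BA; exists i; split=> [j ji|]; rewrite -!val_to_P BA flipE inE.
  by rewrite (negPf ji).
by rewrite eqxx /= setCK.
Qed.

Lemma factor_twin_union A B i j : to_P B = flip [set i] (to_P A) ->
  factor (val A :|: val B) j = if j == i then setT else factor (val A) j.
Proof.
move=> BA; rewrite /factor imsetU -!/(factor _ _) -!val_to_P BA flipE inE.
by case: ifP => _ /=; rewrite ?setUCr ?setUid.
Qed.

Lemma mem_twin_union A B i (x : point X) : to_P B = flip [set i] (to_P A) ->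
  (x \in val A :|: val B) = [forall j, (j != i) ==> (x j \in val (to_P A j))].
Proof.
move=> BA; rewrite inE !mem_proper_box BA.
apply/orP/forallP => [[] /forallP H j|H].
- by apply/implyP => _.
- by apply/implyP => ji; move: (H j); rewrite flipE inE (negPf ji).
have [xi|xi] := boolP (x i \in val (to_P A i)); [left|right];
  apply/forallP => j; move: (H j); case: (eqVneq j i) => [->|ji] //=.
  by rewrite flipE inE eqxx /= inE xi.
by rewrite flipE inE (negPf ji).
Qed.

Lemma eq_twin_union A B C D i k :
  to_P B = flip [set i] (to_P A) -> to_P D = flip [set k] (to_P C) ->
  val A :|: val B = val C :|: val D <-> k = i /\ agree_off i (to_P A) (to_P C).
Proof.
move=> BA DC; split=> [E|[ki A_C]]; last first.
  rewrite ki in DC; apply/setP => x.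
  rewrite (mem_twin_union _ BA) (mem_twin_union _ DC).
  by apply: eq_forallb => j; case: eqVneq => //= ji; rewrite A_C.
have F j := factor_twin_union j BA; have G j := factor_twin_union j DC.
(* The direction of a twin pair can be read off its union: it is the only one with a full factor, as
   the boxes are proper. *)
have ki : k = i.
  apply/eqP/negPn/negP => ki; have := F k.
  rewrite E G eqxx (negPf ki) => /esym/eqP.
  by rewrite (negPf (forallP (andP (valP A)).2 k)).
split=> // j ji; apply: val_inj; rewrite !val_to_P.
by have := F j; rewrite E G ki (negPf ji).
Qed.

Lemma dyadic_labellingP (E : finType) (lam : proper_box X -> E) :
  dyadic_labelling lam <->
  (forall e, exists p, lam (of_P p) = e) /\ line_constant (lam \o of_P).
Proof.
split=> -[surj H]; split.
- by move=> e; have [A <-] := surj e; exists (to_P A); rewrite to_PK.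
- move=> i p q pq; apply: H; try by apply/twin_pairP; exists i; rewrite !of_PK.
  by apply/(@eq_twin_union _ _ _ _ i i); rewrite !of_PK.
- by move=> e; have [p <-] := surj e; exists (of_P p).
move=> A B C D /twin_pairP[i BA] /twin_pairP[k DC].
move/(eq_twin_union BA DC) => [ki A_C]; move: (H i _ _ A_C) => /=.
by rewrite -{2}ki -BA -DC !to_PK.
Qed.

Lemma disjoint_equicomplementary_dichotomous (B B' : {set point (pudX X)}) :
  equicomplementary B -> equicomplementary B' -> [disjoint B & B'] ->
  dichotomous B B'.
Proof.
move=> [boxB eqB] [boxB' eqB'] dis.
(* If the factors met in every direction, a choice of common coordinates would be a common point of
   [B] and [B']. *)
have [i /eqP di] : exists i, factor B i :&: factor B' i == set0.
  apply/existsP; apply: contraT; rewrite negb_exists => /forallP ne.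
  have {}ne i : exists a, a \in factor B i :&: factor B' i by apply/set0Pn.
  pose x : point (pudX X) := [ffun i => xchoose (ne i)].
  have xP i : x i \in factor B i :&: factor B' i.
    by rewrite ffunE; apply: xchooseP.
  move/pred0P: dis => /(_ x) /=; rewrite (mem_box _ boxB) (mem_box _ boxB').
  by move=> /negP[]; apply/andP; split; apply/forallP => i;
     have /setIP[] := xP i.
(* Two disjoint families that each contain exactly one of [C] and [pudC C] are complementary. *)
exists i; apply/setP => C; move/setP in di.
have := eqB i C; have := eqB' i C; have := di C; have := di (pudC C).
by rewrite !inE; do 4![case: (_ \in _)].
Qed.

Lemma partition_line_constant (F : {set {set point (pudX X)}}) :
  partition F [set: point (pudX X)] ->
  (forall Q : {set _}, Q \in F -> equicomplementary Q) -> line_constant (pblock F).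
Proof.
move=> partF eqF; have [/eqP covF tiF _] := and3P partF.
have memF p : p \in pblock F p by rewrite mem_pblock covF inE.
have inF p : pblock F p \in F by rewrite pblock_mem // covF inE.
(* On a line in direction [i] meeting a block, membership in the block depends on the [i]-th
   coordinate only, so exactly one of [q] and its flip lies in the block of [p]. *)
have meet i p q : agree_off i p q ->
    pblock F p \in [set pblock F q; pblock F (flip [set i] q)].
  move=> pq; have [boxB eqB] := eqF _ (inF p).
  have memB r : agree_off i p r -> r i \in factor (pblock F p) i ->
      r \in pblock F p.
    move=> pr ri; rewrite (mem_box _ boxB); apply/forallP => j.
    by case: (eqVneq j i) => [->//|/pr <-]; apply: mem_factor.
  have [qi|qi] := boolP (q i \in factor (pblock F p) i).
    by rewrite (same_pblock tiF (memB _ pq qi)) set21.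
  have /(same_pblock tiF) -> : flip [set i] q \in pblock F p.
    apply: memB => [j ji|]; first by rewrite flipE inE (negPf ji) pq.
    by rewrite flipE inE eqxx; have := eqB i (q i); rewrite (negPf qi).
  by rewrite set22.
have sub i p q : agree_off i p q ->
    [set pblock F p; pblock F (flip [set i] p)] \subset
    [set pblock F q; pblock F (flip [set i] q)].
  move=> pq; apply/subsetP => _ /set2P[] ->; apply: meet => // j ji.
  by rewrite flipE inE (negPf ji) pq.
move=> i p q pq; apply/eqP; rewrite eqEsubset !sub // => j ji.
by rewrite pq.
Qed.

End ProperBoxes.

Theorem theorem4p4 (d : nat) (X : 'I_d -> finType)
    (X_nonempty : forall i : 'I_d, 0 < #|X i|)
    (E : finType) (cardE : #|E| = 2 ^ d)
    (lam : proper_box X -> E) :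
  dyadic_labelling lam <->
  exists (F : {set {set point (pudX X)}})
         (partF : partition F [set: point (pudX X)]),
    [/\ forall B, B \in F -> equicomplementary B,
        forall B B', B \in F -> B' \in F -> B != B' -> dichotomous B B'
      & exists2 g : {B : {set point (pudX X)} | B \in F} -> E,
          bijective g & forall A, lam A = g (lambdaF partF A)].
Proof.
pose mu p := lam (of_P p).
split=> [/dyadic_labellingP[surj line]|[F [partF [eqF _ [g g_bij lamE]]]]].
  pose F := [set fibre mu e | e : E].
  have partF : partition F [set: point (pudX X)].
    apply/and3P; split.
    - apply/eqP/setP => p; rewrite inE; apply/bigcupP.
      by exists (fibre mu (mu p)); [apply: imset_f | rewrite inE].
    - apply/trivIsetP => _ _ /imsetP[e _ ->] /imsetP[e' _ ->] ee'.
      apply/pred0P => p /=; rewrite !inE; apply: contraNF ee'.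
      by case/andP=> /eqP -> /eqP ->.
    apply/imsetP => -[e _ /esym/setP F0]; have [p pe] := surj e.
    by have := F0 p; rewrite !inE /mu pe eqxx.
  have tiF : trivIset F by case/and3P: partF.
  have eqF B : B \in F -> equicomplementary B.
    have cK i : involutive (@pudC (X i)) by apply: pudCK.
    case/imsetP=> e _ ->; split; first exact: (fibre_box cK line surj cardE).
    exact: (fibre_equicomplementary cK line surj cardE).
  have fibreF e : fibre mu e \in F by apply: imset_f.
  have pblockE p : pblock F p = fibre mu (mu p).
    by apply: def_pblock => //; rewrite inE.
  exists F, partF; split=> //.
    move=> B B' BF B'F BB'.
    apply: disjoint_equicomplementary_dichotomous; try exact: eqF.
    exact: (trivIsetP tiF).
  have nonempty (B : {B | B \in F}) : exists p, p \in val B.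
    by apply/set0Pn; case/andP: (eqF _ (valP B)).1.
  (* A block is a fibre, so the label of an arbitrarily chosen point is the label of the whole
     block. *)
  pose g B := mu (xchoose (nonempty B)).
  have gE (B : {B | B \in F}) p : p \in val B -> g B = mu p.
    move=> pB; have := xchooseP (nonempty B); rewrite /g.
    move: (xchoose _) => q; case: B pB => B /= BF.
    by case/imsetP: BF => e _ ->; rewrite !inE => /eqP -> /eqP ->.
  exists g.
    exists (fun e => exist _ (fibre mu e) (fibreF e)) => [B|e].
      apply: val_inj => /=; have [p pB] := nonempty B; rewrite (gE _ _ pB).
      by rewrite -pblockE; apply: def_pblock => //; apply: valP.
    by have [p pe] := surj e; rewrite (gE _ p) //= inE; apply/eqP.
  move=> A; rewrite (gE _ (to_P A)) /mu ?to_PK //=.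
  by rewrite pblockE inE.
have /and3P[_ tiF F0] := partF.
apply/dyadic_labellingP; split=> [e|i p q pq].
  have [h _ hK] := g_bij; have [p pB] : exists p, p \in val (h e).
    by apply/set0Pn; apply: contraNneq F0 => <-; apply: valP.
  exists p; rewrite lamE -[e]hK; congr g; apply: val_inj => /=.
  by rewrite of_PK; apply: def_pblock => //; apply: valP.
(* Pairs of labels are images under [g] of pairs of blocks, which reduces the claim to line
   constancy of [pblock F]. *)
have lamS r s : [set lam (of_P r); lam (of_P s)] =
   g @: [set B | val B \in [set pblock F r; pblock F s]].
  apply/setP => e; apply/set2P/imsetP => [[] ->|[B]].
  - by exists (lambdaF partF (of_P r)); rewrite ?inE /= ?of_PK ?eqxx.
  - by exists (lambdaF partF (of_P s)); rewrite ?inE /= ?of_PK ?eqxx ?orbT.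
  by rewrite inE => /set2P[] Br ->; [left|right]; rewrite lamE; congr g;
     apply: val_inj; rewrite /= of_PK.
by rewrite /= !lamS (partition_line_constant partF eqF pq).
Qed.
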